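(* There is an absolute constant $C>0$ such that the following holds. Let $k \ge 9$ and $r \ge 3$ be integers and let $P$ be an $r$-repetition-free $k$-permutation matrix. Then the Füredi--Hajnal limit of $P$ satisfies \[ c_P \le 2^{C\, r^{1/3} k^{2/3} \log^2 k}. \]
   Context: A binary matrix has entries in $\{0,1\}$. A $k$-permutation matrix is a $k\times k$ binary matrix with exactly one $1$-entry in every row and every column. A binary matrix $A$ contains a binary matrix $B$ if $B$ can be obtained from $A$ by deleting some rows, some columns, and changing some $1$-entries to $0$-entries; otherwise $A$ avoids $B$. For a binary matrix $B$, $\mathrm{ex}(n,B)$ is the maximum number of $1$-entries in an $n\times n$ binary matrix avoiding $B$. For a permutation matrix $P$, the Füredi--Hajnal limit is $c_P=\lim_{n\to\infty}\mathrm{ex}(n,P)/n$ (this limit exists and is finite). A $1$-entry is identified with its position $(i,j)$ (row $i$, column $j$); the distance vector from the entry $(i_1,j_1)$ to the entry $(i_2,j_2)$ is $(i_2-i_1,j_2-j_1)$. A vector is $r$-repeated in a permutation matrix $P$ if it occurs as the distance vector of at least $r$ pairs of $1$-entries of $P$; $P$ is $r$-repetition-free if no vector is $r$-repeated in $P$. Logarithms are base $2$. *)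

(* Defs.v *)
From HB Require Import structures.
From mathcomp Require Import all_boot all_order all_algebra.
From mathcomp Require Import all_classical all_reals all_analysis.

Set Implicit Arguments.
Unset Strict Implicit.
Unset Printing Implicit Defensive.

Import Order.TTheory GRing.Theory Num.Theory.
Import numFieldNormedType.Exports.

Local Open Scope ring_scope.

Definition permutation_matrix (k : nat) (P : 'M[bool]_k) : Prop :=
  (forall i : 'I_k, exists! j : 'I_k, P i j)
  /\ (forall j : 'I_k, exists! i : 'I_k, P i j).

Definition one_entries (m n : nat) (A : 'M[bool]_(m, n)) : {set 'I_m * 'I_n} :=
  [set e | A e.1 e.2].

Definition increasing (p m : nat) (f : {ffun 'I_p -> 'I_m}) : bool :=
  [forall i : 'I_p, forall j : 'I_p, (i < j)%N ==> (f i < f j)%N].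

(* The strictly increasing f and g list the rows and columns of A that are    *)
(* kept, so that [mxsub f g A] is what the deletions leave.                   *)
Definition contains (m n p q : nat) (A : 'M[bool]_(m, n)) (B : 'M[bool]_(p, q))
    : bool :=
  [exists f : {ffun 'I_p -> 'I_m}, exists g : {ffun 'I_q -> 'I_n},
    [&& increasing f, increasing g &
        [forall i, forall j, B i j ==> mxsub f g A i j]]].

Definition avoids (m n p q : nat) (A : 'M[bool]_(m, n)) (B : 'M[bool]_(p, q))
    : bool :=
  ~~ contains A B.

Definition ex (p q : nat) (n : nat) (B : 'M[bool]_(p, q)) : nat :=
  (\max_(A : 'M[bool]_n | avoids A B) #|one_entries A|)%N.

(* The sequence converges for every permutation matrix P (by superadditivity  *)
(* of ex and the Marcus-Tardos theorem), so limn takes no default value here. *)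
Definition furedi_hajnal_limit (R : realType) (k : nat) (P : 'M[bool]_k) : R :=
  limn (fun n : nat => (ex n P)%:R / n%:R : R).

Definition distance_vector (m n : nat) (e1 e2 : 'I_m * 'I_n) : int * int :=
  ((e2.1 : nat)%:Z - (e1.1 : nat)%:Z, (e2.2 : nat)%:Z - (e1.2 : nat)%:Z).

(* The two entries of a pair are distinct: otherwise the zero vector would    *)
(* occur once for each 1-entry. A nonzero vector orders the two entries of    *)
(* each pair, so counting ordered pairs counts every pair once.               *)
Definition repeated (r k : nat) (P : 'M[bool]_k) (v : int * int) : bool :=
  (r <= #|[set ee : ('I_k * 'I_k) * ('I_k * 'I_k) |
            [&& ee.1 \in one_entries P, ee.2 \in one_entries P,
                ee.1 != ee.2 & distance_vector ee.1 ee.2 == v]]|)%N.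

Definition repetition_free (r k : nat) (P : 'M[bool]_k) : Prop :=
  forall v : int * int, ~~ repeated r P v.

Definition log2 (R : realType) (x : R) : R := ln x / ln 2.

(* Main.v *)
(* After Marcus-Tardos and Fox: cut the matrix into t x t blocks with t of    *)
(* order k^2. Blocks that are neither wide nor tall have few ones, so all is  *)
(* in showing that few blocks of a strip are wide, i.e. that a matrix A with  *)
(* t columns, N = 2^O(r^(1/3) k^(2/3) log^2 k) rows and sqrt(t)/2 ones in     *)
(* each row contains P. Call a column hit by a window of consecutive rows if  *)
(* it has a one there. Descending the tree of windows of A, the number of hit *)
(* columns can drop only from t to sqrt(t)/2, so some window splits into M    *)
(* parts (M of order k) each of which, on average, hits all but an epsilon-   *)
(* fraction of its columns, with 1/epsilon of order r^(1/3) k^(2/3). It       *)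
(* remains to embed P into an M x M matrix with a proportion of at most       *)
(* epsilon zeros.                                                             *)
(* Let q be of order (k/r)^(1/3). Discard the groups of q consecutive rows or *)
(* columns with more than q^2/64 zeros, and place P by a random translation,  *)
(* its groups of q rows or columns being spread so that each can still be     *)
(* shifted by less than q. Few 1-entries of P land on a zero; such an entry   *)
(* is moved to a one by shifting its two groups. This need not spoil another  *)
(* entry, because nearby entries of P rarely meet zeros together: two zeros   *)
(* in a given relative position are met by less than r pairs of 1-entries.    *)

Require Import Defs.
From HB Require Import structures.
From mathcomp Require Import all_boot all_order all_algebra.
From mathcomp Require Import all_classical all_reals all_analysis.
From mathcomp Require Import zify ring lra.

Set Implicit Arguments.
Unset Strict Implicit.
Unset Printing Implicit Defensive.

Import Order.TTheory GRing.Theory Num.Theory.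
Import numFieldNormedType.Exports.

Local Open Scope nat_scope.

(** * Occurrences of a permutation and sums *)

(** In quantitative terms, let [d] be about [k / q] and [M = 8 * q * d], which is of order k.
    [ones_linear_bound] is the block recursion: with [t = 4 * (s * s)] the thin blocks cost only a
    factor t/4 per level, so ex(n, P) is at most 8tNn as soon as every matrix with [t] columns, [N]
    rows and [s] ones per row contains P and its transpose. [occurs_wide] provides this for [s = M]
    and [N = M ^ D]. Each unsuccessful descent to a smaller window shrinks the number of hit columns
    by the factor 1 - 1/E with E = 2048d, and only a total factor 4M is available, so D of order d
    log k suffices. Hence log c_P is of order d log^2 k, and the theorem is a matter of tolerating a
    proportion of zeros of order 1/d with d as small as possible.

    [occurs_sparse] tolerates the proportion 1/(1024d); after light groups are selected it rests on
    [occurs_regular]. There a group of q lines has at most m <= q^2/64 zeros, so there are O(dm)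
    zeros, each with O(m) zeros in nearby groups. By repetition-freeness a pair of zeros is met by
    at most r pairs of entries for all translations together ([close_pairs_count]). Over the order
    of (qd)^2 translations the average number of conflicts is O(r d m^2 / (qd)^2) = O(r q^3 / k).
    Keeping it below a constant allows q of order (k/r)^(1/3), that is, d of order r^(1/3) k^(2/3).
    For such a translation [repair] removes the remaining bad entries. *)

Definition increasing_below (k : nat) (f : nat -> nat) : Prop :=
  forall i j, i < j < k -> f i < f j.

(** Matrices are relations on all of [nat], so blocks, windows and contractions need no change of
    type; a size enters only through the support of the relation. *)
Definition occurs (k : nat) (pi : nat -> nat) (A : rel nat) : Prop :=
  exists f g, [/\ increasing_below k f, increasing_below k g &
    forall i, i < k -> A (f i) (g (pi i))].

Definition inverse_below (k : nat) (pi pi' : nat -> nat) : Prop :=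
  forall i, i < k -> [/\ pi i < k, pi' i < k, pi' (pi i) = i & pi (pi' i) = i].

Lemma inverse_below_sym k pi pi' :
  inverse_below k pi pi' -> inverse_below k pi' pi.
Proof. by move=> H i /H []. Qed.

Lemma occurs_sym k pi pi' (A : rel nat) :
  inverse_below k pi pi' ->
  occurs k pi A -> occurs k pi' (fun x y => A y x).
Proof.
move=> H [f [g [fi gi Hf]]]; exists g, f; split=> // i ik.
by have [_ pik _ pii] := H i ik; have := Hf _ pik; rewrite pii.
Qed.

(** Each row and column of the pattern carries a single one, so the ones can be lifted
    independently. A monotone map never reverses order, so lifts of strictly increasing indices are
    strictly increasing. It is used with maps that collapse windows or blocks to single lines. *)
Lemma occurs_contract k pi pi' (A A' : rel nat) (phi psi : nat -> nat) :
  inverse_below k pi pi' ->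
  {homo phi : x y / x <= y} -> {homo psi : x y / x <= y} ->
  (forall x y, A' x y -> exists x' y', [/\ phi x' = x, psi y' = y & A x' y']) ->
  occurs k pi A' -> occurs k pi A.
Proof.
move=> Hpi Hphi Hpsi HA [f [g [fi gi Hf]]].
have /choice[h hP] : forall i, exists xy : nat * nat, i < k ->
    [/\ phi xy.1 = f i, psi xy.2 = g (pi i) & A xy.1 xy.2].
  move=> i; case: (ltnP i k) => ik; last by exists (0, 0).
  have [x [y [? ? ?]]] := HA _ _ (Hf i ik).
  by exists (x, y).
exists (fun i => (h i).1), (fun j => (h (pi' j)).2); split.
- move=> i j /andP[ij jk]; have ik := ltn_trans ij jk.
  rewrite ltnNge; apply/negP => /Hphi.
  have [-> _ _] := hP i ik; have [-> _ _] := hP j jk.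
  by rewrite leqNgt fi ?ij.
- move=> i j /andP[ij jk]; have ik := ltn_trans ij jk.
  rewrite ltnNge; apply/negP => /Hpsi.
  have [_ pik _ pii] := Hpi i ik; have [_ pjk _ pij] := Hpi j jk.
  have [_ -> _] := hP _ pik; have [_ -> _] := hP _ pjk.
  by rewrite pii pij leqNgt gi ?ij.
- move=> i ik; have [_ _ -> _] := Hpi i ik.
  by have [] := hP i ik.
Qed.

Lemma occurs_sub k pi pi' n m (A A' : rel nat) (phi psi : nat -> nat) :
  inverse_below k pi pi' ->
  increasing_below n phi -> increasing_below m psi ->
  (forall x y, A' x y -> [/\ x < n, y < m & A (phi x) (psi y)]) ->
  occurs k pi A' -> occurs k pi A.
Proof.
move=> Hpi Hphi Hpsi HA [f [g [fi gi Hf]]].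
exists (phi \o f), (psi \o g); split=> /=.
- move=> i j ijk; apply: Hphi; rewrite fi //=.
  by have [] := HA _ _ (Hf j (proj2 (andP ijk))).
- move=> i j ijk; apply: Hpsi; rewrite gi //=.
  have [_ pjk _ pij] := Hpi j (proj2 (andP ijk)).
  by have := HA _ _ (Hf _ pjk); rewrite pij => -[].
- by move=> i /Hf /HA [].
Qed.

Lemma leq_sum_injective (I J : finType) (h : I -> J) (F : J -> nat) :
  injective h -> \sum_i F (h i) <= \sum_j F j.
Proof.
move=> hI; rewrite [leqRHS](bigID (mem (finset.imset h (mem predT)))) /=.
by rewrite big_imset ?leq_addr // => i j _ _ /hI.
Qed.

Lemma leq_sum_inj (I : finType) (phi : I -> nat) n (F : nat -> nat) :
  injective phi -> (forall i, phi i < n) ->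
  \sum_i F (phi i) <= \sum_(x < n) F x.
Proof.
move=> phiI phin; pose psi i := Ordinal (phin i).
have psiI : injective psi by move=> i j /(congr1 val) /phiI.
exact: (leq_sum_injective (fun x : 'I_n => F x) psiI).
Qed.

Lemma leq_sum_shift n w c (F : nat -> nat) :
  w + c <= n -> \sum_(u < w) F (u + c) <= \sum_(x < n) F x.
Proof.
move=> wcn; apply: (@leq_sum_inj 'I_w (fun u => u + c)).
  by move=> i j /addIn /val_inj.
by move=> i; have := ltn_ord i; lia.
Qed.

Lemma exists_leq_average n (F : nat -> nat) c :
  \sum_(x < n) F x < n * c -> exists2 x, x < n & F x < c.
Proof.
move=> H; apply: contrapT => H'; move: H; apply/negP; rewrite -leqNgt.
rewrite -[X in X * _]card_ord -sum_nat_const leq_sum // => i _.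
by rewrite leqNgt; apply/negP => lt; apply: H'; exists i.
Qed.

(** * Pairs of zeros met by a spread permutation *)

(* Groups of [q] consecutive indices are sent to the first halves of          *)
(* consecutive intervals of length [2 * q], so that a group can still be      *)
(* shifted by less than [q] on its own.                                       *)
Definition spread (q i : nat) : nat := 2 * q * (i %/ q) + i %% q.

(** Remainders mod q add up to less than 2q, so sums of two spread values have no carry in base 2q.
    Thus spreading creates no new coincidences among distance vectors, and the repetition bound
    survives it. *)
Lemma spread_diff q i j i' j' : 0 < q ->
  spread q i + spread q j' = spread q j + spread q i' -> i + j' = j + i'.
Proof.
move=> q0; rewrite /spread => H.
have Hi := ltn_pmod i q0; have Hj := ltn_pmod j q0.
have Hi' := ltn_pmod i' q0; have Hj' := ltn_pmod j' q0.
rewrite (divn_eq i q) (divn_eq j q) (divn_eq i' q) (divn_eq j' q).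
set A := i %/ q in H *; set B := j %/ q in H *.
set A' := i' %/ q in H *; set B' := j' %/ q in H *.
have H1 : (A + B') * (2 * q) + (i %% q + j' %% q)
        = (B + A') * (2 * q) + (j %% q + i' %% q) by lia.
have Q0 : 0 < 2 * q by lia.
have E : A + B' = B + A'.
  have := congr1 (fun x => x %/ (2 * q)) H1.
  by rewrite !divnMDl // !divn_small ?addn0 //; lia.
by have := congr1 (fun x => x * q) E; rewrite E in H1; lia.
Qed.

Lemma spread_bound q d i : 0 < q -> i < q * d -> spread q i + q <= 2 * q * d.
Proof.
move=> q0 iqd; rewrite /spread.
have Hi := ltn_pmod i q0.
have Hd : i %/ q < d by rewrite ltn_divLR // mulnC.
have : q * (i %/ q).+1 <= q * d by rewrite leq_mul.
by lia.
Qed.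

Lemma spread_increasing q i j a b :
  0 < q -> i < j -> a < q ->
  (i %/ q = j %/ q -> a = b) -> spread q i + a < spread q j + b.
Proof.
move=> q0 ij aq Hab; rewrite /spread.
have Hi := ltn_pmod i q0; have Hj := ltn_pmod j q0.
have := leq_div2r q (ltnW ij); rewrite leq_eqVlt => /orP[/eqP e|lt].
  rewrite (Hab e) e; have := divn_eq i q; have := divn_eq j q; rewrite e; lia.
have : q * (i %/ q).+1 <= q * (j %/ q) by rewrite leq_mul.
by lia.
Qed.

Lemma spread_group_close q x1 x2 i j a :
  0 < q -> a < q -> i %/ q = j %/ q ->
  x2 + spread q i = x1 + spread q j + a ->
  (x1 %/ q <= (x2 %/ q).+1) && (x2 %/ q <= (x1 %/ q).+2).
Proof.
move=> q0 aq ij H.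
have Hi := ltn_pmod i q0; have Hj := ltn_pmod j q0.
rewrite /spread ij in H.
have lo : x1 < x2 + q by lia.
have hi : x2 < x1 + q * 2 by lia.
apply/andP; split.
  have := leq_div2r q (ltnW lo); rewrite divnDr ?dvdnn // divnn q0; lia.
have := leq_div2r q (ltnW hi).
by rewrite divnDr ?dvdn_mulr // mulKn //; lia.
Qed.

Lemma sum_close_groups q n m (z : rel nat) x :
  (forall g, \sum_(x < n) \sum_(y < n) ((x %/ q == g) && z x y) <= m) ->
  \sum_(x' < n) \sum_(y' < n)
    [&& x %/ q <= (x' %/ q).+1, x' %/ q <= (x %/ q).+2 & z x' y'] <= 4 * m.
Proof.
move=> Hm.
(* The four groups run from one before the group of [x] to two after it. For group 0 the truncated
   subtraction lists group 0 twice, which only overcounts. *)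
apply: (@leq_trans (\sum_(e < 4) \sum_(x' < n) \sum_(y' < n)
   ((x' %/ q == x %/ q + e - 1) && z x' y'))); last first.
  rewrite -[X in X * m](card_ord 4) -sum_nat_const; apply: leq_sum => e _.
  exact: Hm.
rewrite [leqRHS]exchange_big /=; apply: leq_sum => x' _.
rewrite [leqRHS]exchange_big /=; apply: leq_sum => y' _.
case: (z x' y'); rewrite ?andbT ?andbF //.
case: (boolP (_ && _)) => [/andP[h1 h2]|//].
have e4 : (x' %/ q).+1 - x %/ q < 4 by lia.
have xE : x %/ q + ((x' %/ q).+1 - x %/ q) - 1 = x' %/ q.
  move: h1; clear. move: (x %/ q) (nat_of_ord x' %/ q) => X Y h1; lia.
by rewrite (bigD1 (Ordinal e4)) //= xE eqxx.
Qed.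

Lemma sum_all_groups q n m d (z : rel nat) : 0 < q -> n = q * d ->
  (forall g, \sum_(x < n) \sum_(y < n) ((x %/ q == g) && z x y) <= m) ->
  \sum_(x < n) \sum_(y < n) (z x y : nat) <= d * m.
Proof.
move=> q0 nqd Hm.
apply: (@leq_trans (\sum_(g < d) \sum_(x < n) \sum_(y < n)
   ((x %/ q == g) && z x y))); last first.
  rewrite -[X in X * m](card_ord d) -sum_nat_const; apply: leq_sum => e _.
  exact: Hm.
rewrite [leqRHS]exchange_big /=; apply: leq_sum => x _.
rewrite [leqRHS]exchange_big /=; apply: leq_sum => y _.
have xd : x %/ q < d by rewrite ltn_divLR // mulnC -nqd.
by rewrite (bigD1 (Ordinal xd)) //= eqxx leq_addr.
Qed.

Section ClosePairs.
Variables (k q d m rho : nat) (r c : nat -> nat) (z : rel nat).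
Hypotheses (q0 : 0 < q)
  (Hrc : forall i, i < k -> r i < q * d /\ c i < q * d)
  (Hrep : forall i0 j0, i0 < k -> j0 < k ->
     \sum_(i < k) \sum_(j < k) [&& i != j :> nat, r i + r j0 == r j + r i0
        & c i + c j0 == c j + c i0] <= rho)
  (Hm : forall g, \sum_(x < 4 * q * d) \sum_(y < 4 * q * d)
     ((x %/ q == g) && z x y) <= m).
Variables (a b : nat).
Hypotheses (aq : a < q) (bq : b < q).

Let n := 4 * q * d.
Let R i := spread q (r i).
Let C i := spread q (c i).

Let realizes i j x1 y1 x2 y2 :=
  [&& i != j :> nat, r i %/ q == r j %/ q, x2 + R i == x1 + R j + a
    & y2 + C i == y1 + C j + b].

(** All pairs realizing the same two zeros have the distance vector of any one of them, by
    [spread_diff]. Since the two entries share a row group, zeros in distant groups are realized by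
    none. *)
Lemma realizations_bound x1 y1 x2 y2 :
  \sum_(i < k) \sum_(j < k) realizes i j x1 y1 x2 y2 <=
    (if (x1 %/ q <= (x2 %/ q).+1) && (x2 %/ q <= (x1 %/ q).+2) then rho else 0).
Proof.
case: (pselect (exists ij : 'I_k * 'I_k, realizes ij.1 ij.2 x1 y1 x2 y2)).
  move=> [[i0 j0] /= /and4P[_ /eqP e0 /eqP f0 /eqP g0]].
  rewrite (spread_group_close q0 aq e0 f0).
  apply: leq_trans (Hrep (ltn_ord i0) (ltn_ord j0)).
  apply: leq_sum => i _; apply: leq_sum => j _.
  case Hr: (realizes i j x1 y1 x2 y2) => //.
  case/and4P: Hr => -> /eqP e /eqP f /eqP g /=.
  rewrite lt0b; apply/andP; split; apply/eqP.
    apply: (@spread_diff q) => //; rewrite -/(R _) -/(R _) -/(R _) -/(R _); lia.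
  by apply: (@spread_diff q) => //; rewrite -/(C _) -/(C _) -/(C _) -/(C _); lia.
move=> H; rewrite big1 // => i _; rewrite big1 // => j _.
by apply/eqP; rewrite eqb0; apply/negP => Hr; apply: H; exists (i, j).
Qed.

(** Double counting: a translation and a pair of entries determine the two zeros met. The first is
    one of at most [4 * d * m] zeros, the second one of at most [4 * m] zeros in nearby groups, and
    each pair of zeros is realized at most [rho] times. *)
Lemma close_pairs_count :
  \sum_(u < 2 * q * d) \sum_(v < 2 * q * d) \sum_(i < k) \sum_(j < k)
    [&& i != j :> nat, r i %/ q == r j %/ q, z (u + R i) (v + C i)
      & z (u + R j + a) (v + C j + b)] <= rho * (4 * d * m) * (4 * m).
Proof.
pose H i j x1 y1 := \sum_(x2 < n) \sum_(y2 < n)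
  ([&& z x1 y1, z x2 y2 & realizes i j x1 y1 x2 y2] : nat).
apply: (@leq_trans (\sum_(i < k) \sum_(j < k) \sum_(x1 < n) \sum_(y1 < n)
   H i j x1 y1)).
  under eq_bigr do rewrite exchange_big /=.
  rewrite exchange_big /=; apply: leq_sum => i _.
  under eq_bigr do rewrite exchange_big /=.
  rewrite exchange_big /=; apply: leq_sum => j _.
  have [ri ci] := Hrc (ltn_ord i); have [rj cj] := Hrc (ltn_ord j).
  have Rj := spread_bound q0 rj; have Cj := spread_bound q0 cj.
  have Ri := spread_bound q0 ri; have Ci := spread_bound q0 ci.
  apply: (@leq_trans (\sum_(u < 2 * q * d) \sum_(y1 < n) H i j (u + R i) y1)).
    apply: leq_sum => u _.
    apply: leq_trans (@leq_sum_shift n (2 * q * d) (C i) _ _); last first.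
      by rewrite /n /C; lia.
    apply: leq_sum => v _; rewrite /H.
    case: (boolP [&& _, _, _ & _]) => [/and4P[h1 h2 h3 h4]|//].
    have x2n : u + R j + a < n by have := ltn_ord u; rewrite /n /R; lia.
    have y2n : v + C j + b < n by have := ltn_ord v; rewrite /n /C; lia.
    rewrite (bigD1 (Ordinal x2n)) //= (bigD1 (Ordinal y2n)) //=.
    rewrite /realizes h1 h2 h3 h4 /=.
    have -> : u + R j + a + R i == u + R i + R j + a by apply/eqP; lia.
    by have -> : v + C j + b + C i == v + C i + C j + b by apply/eqP; lia.
  apply: (@leq_sum_shift n (2 * q * d) (R i)
     (fun x1 => \sum_(y1 < n) H i j x1 y1)).
  by rewrite /n /R; lia.
apply: (@leq_trans (\sum_(x1 < n) \sum_(y1 < n) \sum_(x2 < n) \sum_(y2 < n)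
   rho * ([&& z x1 y1 & [&& x1 %/ q <= (x2 %/ q).+1,
      x2 %/ q <= (x1 %/ q).+2 & z x2 y2]] : nat))).
  rewrite pair_big /=.
  rewrite exchange_big /=; apply: leq_sum => x1 _.
  rewrite exchange_big /=; apply: leq_sum => y1 _.
  rewrite exchange_big /=; apply: leq_sum => x2 _.
  rewrite exchange_big /=; apply: leq_sum => y2 _.
  case: (z x1 y1) => /=; last by rewrite big1.
  case: (z x2 y2) => /=; last by rewrite big1.
  rewrite andbT; have := realizations_bound x1 y1 x2 y2.
  rewrite pair_big /= => /leq_trans; apply.
  by case: ifP => // _; rewrite muln1.
under eq_bigr do under eq_bigr do under eq_bigr do rewrite -big_distrr /=.
under eq_bigr do under eq_bigr do rewrite -big_distrr /=.
apply: (@leq_trans (\sum_(x1 < n) \sum_(y1 < n) rho * (4 * m) * z x1 y1)).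
  apply: leq_sum => x1 _; apply: leq_sum => y1 _.
  case: (z x1 y1) => /=; last first.
    by rewrite big1 ?muln0 // => ? _; rewrite big1.
  by rewrite muln1 leq_mul // sum_close_groups.
under eq_bigr do rewrite -big_distrr /=.
rewrite -big_distrr /= mulnAC leq_mul2r leq_mul2l; apply/orP; right.
apply/orP; right; apply: (@sum_all_groups q n) => //.
by rewrite /n; lia.
Qed.
End ClosePairs.

(** * Repairing the entries that meet zeros *)

Lemma markov_strict n (F : nat -> nat) c :
  (\sum_(x < n) (c < F x)) * c.+1 <= \sum_(x < n) F x.
Proof.
rewrite big_distrl; apply: leq_sum => x _ /=.
by case: ltnP => // ?; rewrite mul1n.
Qed.

(* [bad i a b]: the entry [i] meets a zero when its row group is shifted by    *)
(* [a] and its column group by [b]. By [T0] the entries that are bad without   *)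
(* shifts share no group. Each of them chooses the shift of its column group,  *)
(* and once all these are fixed, the shift of its row group; within each of    *)
(* the two rounds the choices are independent of each other.                   *)
Section Repair.
Variables (k q : nat) (R C : 'I_k -> nat) (bad : 'I_k -> nat -> nat -> bool).
Hypotheses (q0 : 0 < q)
  (T0 : forall i j, i != j -> R i = R j \/ C i = C j ->
     bad i 0 0 -> bad j 0 0 -> False)
  (T1 : 64 * (\sum_i \sum_j [&& i != j, R i == R j & bad i 0 0]
          * \sum_(a < q) bad j a 0) < q)
  (T2 : 64 * (\sum_i \sum_j [&& i != j, C i == C j & bad i 0 0]
          * \sum_(b < q) bad j 0 b) < q)
  (T3 : 64 * (\sum_i \sum_j [&& i != j, C i == C j & bad i 0 0]
          * \sum_(b < q) \sum_(a < q) bad j a b) < q * q)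
  (Hbox : forall i, 32 * \sum_(b < q) \sum_(a < q) bad i a b <= q * q).

(** The harm that shifting the column group of [i] by [b] does to the second round: the row shifts
    it forbids to the other entries of that group. *)
Let cost i b := \sum_j [&& i != j, C i == C j & bad i 0 0]
                  * \sum_(a < q) bad j a b.

(** By Markov's inequality the three requirements exclude at most q/8, fewer than q/64, and at most
    q/2 of the shifts, so one remains. *)
Lemma column_shift s : bad s 0 0 -> exists b, [/\ b < q,
  4 * \sum_(a < q) bad s a b <= q,
  forall i, s != i -> C s = C i -> ~~ bad i 0 b
  & q * cost s b <= 2 * \sum_(b' < q) cost s b'].
Proof.
move=> Hs; set T := \sum_(b' < q) cost s b'.
pose A b := 4 * \sum_(a < q) bad s a b.
pose G b := \sum_j [&& s != j, C s == C j & bad s 0 0] * (bad j 0 b : nat).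
have M1 := markov_strict q A q.
have M2 := markov_strict q G 0.
have M3 := markov_strict q (fun b => q * cost s b) (2 * T).
have S1 : 8 * \sum_(b < q) A b <= q * q.
  by rewrite /A -big_distrr /= mulnA; exact: Hbox.
have S2 : 64 * \sum_(b < q) G b < q.
  apply: leq_ltn_trans T2; rewrite leq_mul2l /= /G exchange_big /=.
  rewrite [leqRHS](bigD1 s) //=.
  by under eq_bigr do rewrite -big_distrr /=; exact: leq_addr.
have S3 : \sum_(b < q) q * cost s b = q * T by rewrite big_distrr.
have [|b bq Hb] := @exists_leq_average q
  (fun b => (q < A b) + (0 < G b) + (2 * T < q * cost s b)) 1.
  rewrite !big_split /=; move: M1 M2 M3 S1 S2; rewrite S3.
  move: (\sum_(x < q) _) (\sum_(x < q) _) (\sum_(x < q) _) (\sum_(x < q) _)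
    (\sum_(x < q) _) => f3 SG f2 SA f1 M1 M2 M3 S1 S2.
  have f1q : 8 * f1 <= q.
    rewrite leqNgt; apply/negP => h.
    have : q.+1 * q.+1 <= 8 * f1 * q.+1 by rewrite leq_mul2r h orbT.
    by lia.
  have f3q : 2 * f3 <= q.
    rewrite leqNgt; apply/negP => h.
    have : q.+1 * (2 * T).+1 <= 2 * f3 * (2 * T).+1 by rewrite leq_mul2r h orbT.
    by lia.
  by lia.
exists b; split=> //.
- by rewrite leqNgt; apply/negP => h; move: Hb; rewrite /A h.
- move=> i si Ci; apply/negP => h; move: Hb.
  have : 0 < G b by rewrite /G (bigD1 i) //= si Ci eqxx Hs h.
  by move=> ->; rewrite addnAC ltnS leqn0 addn1.
- by rewrite leqNgt; apply/negP => h; move: Hb; rewrite h addn1.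
Qed.

Lemma repair : exists alpha beta : nat -> nat,
  [/\ forall g, alpha g < q, forall g, beta g < q
    & forall i, ~~ bad i (alpha (R i)) (beta (C i))].
Proof.
have /choice[bs bsP] : forall s, exists b, bad s 0 0 -> [/\ b < q,
    4 * \sum_(a < q) bad s a b <= q,
    forall i, s != i -> C s = C i -> ~~ bad i 0 b
    & q * cost s b <= 2 * \sum_(b' < q) cost s b'].
  move=> s; case: (boolP (bad s 0 0)) => [/column_shift [b]|_]; last by exists 0.
  by exists b.
have cost_bound : 32 * \sum_s cost s (bs s) < q.
  have : q * \sum_s cost s (bs s) <= 2 * \sum_s \sum_(b < q) cost s b.
    rewrite !big_distrr; apply: leq_sum => s _ /=.
    case: (boolP (bad s 0 0)) => Hs; first by case: (bsP s Hs).
    rewrite {1}/cost big1 ?muln0 // => j _.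
    by rewrite (negbTE Hs) !andbF.
  have : 64 * \sum_s \sum_(b < q) cost s b < q * q.
    apply: leq_ltn_trans T3; rewrite leq_mul2l /=.
    apply: leq_sum => s _; rewrite /cost exchange_big /=.
    by apply: leq_sum => j _; rewrite -big_distrr.
  move=> h2 h1; rewrite -(ltn_pmul2l q0); apply: leq_ltn_trans h2; lia.
(* Groups without a bad entry keep the shift 0. By [T0] a group has at most one bad entry, so the
   choice made by [pick] is forced. *)
pose beta g := if [pick s | bad s 0 0 && (C s == g)] is Some s then bs s else 0.
have betaq g : beta g < q.
  by rewrite /beta; case: pickP => // s /andP[/bsP[]].
have betaS s : bad s 0 0 -> beta (C s) = bs s.
  move=> Hs; rewrite /beta; case: pickP => [s' /andP[Hs' /eqP Css']|].
    have [->//|ne] := eqVneq s' s.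
    by case: (T0 ne (or_intror Css') Hs' Hs).
  by move=> /(_ s); rewrite Hs eqxx.
have /choice[as_ asP] : forall s, exists a, bad s 0 0 -> [/\ a < q,
    ~~ bad s a (bs s)
    & forall i, s != i -> R s = R i -> ~~ bad i a (beta (C i))].
  move=> s; case: (boolP (bad s 0 0)) => [Hs|_]; last by exists 0.
  pose F a := (bad s a (bs s)) +
    \sum_i (s != i) && (R s == R i) * (bad i a (beta (C i)) : nat).
  have [|a aq Ha] := @exists_leq_average q F 1.
    rewrite muln1 /F big_split /= exchange_big /=.
    have [_ h _ _] := bsP s Hs.
    set X := (X in _ + X < _).
    suff : X <= (\sum_i \sum_j [&& i != j, R i == R j & bad i 0 0]
          * \sum_(a < q) bad j a 0) + \sum_s cost s (bs s).
      move: h T1 cost_bound; clearbody X; move: (\sum_(a < q) bad s _ _).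
      by move: (\sum_i \sum_j _) (\sum_s _) => Y Y' X'; lia.
    rewrite /X [in leqRHS](bigD1 s) //= -[leqRHS]addnA.
    apply: leq_trans (leq_add (leqnn _) (leq_addl _ _)).
    rewrite /cost [in leqRHS]exchange_big -big_split; apply: leq_sum => i _ /=.
    rewrite -big_distrr /= Hs andbT.
    case: (boolP (_ && _)) => // /andP[si /eqP Rsi]; rewrite !mul1n.
    (* If the column group of [i] stays put, the row term pays. Otherwise it was shifted for some
       [s'], whose cost pays; [s'] differs from [i] because [T0] forbids a second bad entry in the
       row group of [s]. *)
    rewrite /beta; case: pickP => [s' /andP[Hs' /eqP Cs']|_]; last exact: leq_addr.
    apply: leq_trans (leq_addl _ _); rewrite (bigD1 s') //= Cs' eqxx Hs'.
    have [s'i|_] := eqVneq s' i; last by rewrite mul1n leq_addr.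
    by case: (T0 si (or_introl Rsi) Hs); rewrite -s'i.
  exists a => _; split=> //.
    by apply/negP => h; move: Ha; rewrite /F h.
  move=> i si Rsi; apply/negP => h; move: Ha.
  by rewrite /F (bigD1 i) //= si Rsi eqxx h addnCA.
pose alpha g := if [pick s | bad s 0 0 && (R s == g)] is Some s then as_ s else 0.
exists alpha, beta; split=> //.
  by move=> g; rewrite /alpha; case: pickP => // s /andP[/asP[]].
move=> i; rewrite /alpha; case: pickP => [s /andP[Hs /eqP Rs]|noR].
  have [_ h1 h2] := asP s Hs.
  have [e|ne] := eqVneq s i; last exact: h2.
  by rewrite -e betaS.
rewrite /beta; case: pickP => [s /andP[Hs /eqP Cs]|noC].
  have [_ _ h _] := bsP s Hs; apply: h => //.
  by apply/eqP => e; move: (noR s); rewrite Hs e eqxx.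
by apply/negP => h; move: (noC i); rewrite h eqxx.
Qed.
End Repair.

(** * Random translation when every group has few zeros *)

Section Regular.
Variables (k q d m rho : nat) (pi pi' : nat -> nat) (z : rel nat).
Hypotheses (q0 : 0 < q) (k0 : 0 < k) (kqd : k <= q * d)
  (rhoq : rho * q ^ 3 <= k) (mq : 64 * m <= q * q)
  (Hpi : inverse_below k pi pi')
  (Hrep : forall i0 j0, i0 < k -> j0 < k ->
     \sum_(i < k) \sum_(j < k) [&& i != j :> nat, i + j0 == j + i0
        & pi i + pi j0 == pi j + pi i0] <= rho)
  (Hrow : forall g, \sum_(x < 4 * q * d) \sum_(y < 4 * q * d)
     ((x %/ q == g) && z x y) <= m)
  (Hcol : forall g, \sum_(x < 4 * q * d) \sum_(y < 4 * q * d)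
     ((y %/ q == g) && z x y) <= m).

Let n := 4 * q * d.
Let w := 2 * q * d.
Let bad u v (i : 'I_k) a b :=
  z (u + spread q i + a) (v + spread q (pi i) + b).
Let R (i : 'I_k) := i %/ q.
Let C (i : 'I_k) := pi i %/ q.
Let N (G : 'I_k -> nat) u v a b := \sum_i \sum_j
  [&& i != j, G i == G j & bad u v i 0 0] * (bad u v j a b : nat).

Let pi_bound i : i < k -> i < q * d /\ pi i < q * d.
Proof. by move=> ik; have [h _ _ _] := Hpi ik; split; lia. Qed.

Let count_R a b : a < q -> b < q ->
  \sum_(u < w) \sum_(v < w) N R u v a b <= rho * (4 * d * m) * (4 * m).
Proof.
move=> aq bq.
have := close_pairs_count q0 pi_bound Hrep Hrow aq bq.
apply: leq_trans; apply: leq_sum => u _; apply: leq_sum => v _.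
apply: leq_sum => i _; apply: leq_sum => j _.
by rewrite /bad /R !addn0 mulnb -!andbA.
Qed.

Let count_C a b : a < q -> b < q ->
  \sum_(u < w) \sum_(v < w) N C u v a b <= rho * (4 * d * m) * (4 * m).
Proof.
move=> aq bq.
have pib i : i < k -> pi i < q * d /\ i < q * d by move=> /pi_bound [].
have rep' i0 j0 : i0 < k -> j0 < k ->
   \sum_(i < k) \sum_(j < k) [&& i != j :> nat, pi i + pi j0 == pi j + pi i0
        & i + j0 == j + i0] <= rho.
  move=> ik jk; apply: leq_trans (Hrep ik jk).
  by apply: leq_sum => i _; apply: leq_sum => j _; rewrite [X in _ && X]andbC.
have col' g : \sum_(x < n) \sum_(y < n) ((x %/ q == g) && z y x) <= m.
  by rewrite exchange_big; exact: Hcol.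
have := @close_pairs_count _ _ _ _ _ _ _ (fun x y => z y x)
  q0 pib rep' col' b a bq aq.
apply: leq_trans; rewrite exchange_big.
apply: leq_sum => u _; apply: leq_sum => v _.
apply: leq_sum => i _; apply: leq_sum => j _.
by rewrite /bad /C !addn0 mulnb -!andbA.
Qed.

(** One quantity whose smallness yields all the hypotheses [T0] to [T3] of [repair]. The conflicts
    without shifts are counted q^2 times, so a weight below q^2 / 64 forces them to be absent. *)
Let weight u v := \sum_(a < q) \sum_(b < q)
  (N R u v 0 0 + N C u v 0 0 + N R u v a 0 + N C u v 0 b + N C u v a b).

Let good_offset : exists u v, [/\ u < w, v < w & 64 * weight u v < q * q].
Proof.
have H : \sum_(u < w) \sum_(v < w) weight u v
    <= q * q * (5 * (rho * (4 * d * m) * (4 * m))).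
  rewrite /weight.
  under eq_bigr do rewrite exchange_big /=.
  rewrite exchange_big /= -mulnA -[X in _ <= X * _]card_ord -sum_nat_const.
  apply: leq_sum => a _.
  under eq_bigr do rewrite exchange_big /=.
  rewrite exchange_big /= -[X in _ <= X * _]card_ord -sum_nat_const.
  apply: leq_sum => b _.
  under eq_bigr do rewrite !big_split /=.
  rewrite !big_split /=.
  set B := rho * _ * _; have -> : 5 * B = B + B + B + B + B by lia.
  by rewrite !leq_add // ?count_R ?count_C.
have d0 : 0 < d by case: (d) kqd => //; rewrite muln0; lia.
(* This is where the size of [q] matters: it bounds the average number of conflicts per translation
   by a constant. *)
have rq : rho * (q * q) <= d.
  by rewrite -(leq_pmul2l q0) (leq_trans _ kqd) // (leq_trans _ rhoq) //; lia.
have mm : 64 * m * (64 * m) <= q * q * (q * q) by rewrite leq_mul.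
have key : 64 * (q * q * (5 * (rho * (4 * d * m) * (4 * m)))) < w * (w * (q * q)).
  have e1 : 64 * (64 * (q * q * (5 * (rho * (4 * d * m) * (4 * m))))) =
      80 * (d * (rho * (q * q))) * (64 * m * (64 * m)) by lia.
  have e2 : 64 * (w * (w * (q * q))) = 256 * (d * d) * (q * q * (q * q)).
    by rewrite /w; lia.
  rewrite -(@ltn_pmul2l 64) // e1 e2.
  apply: (@leq_ltn_trans (80 * (d * d) * (q * q * (q * q)))).
    by rewrite leq_mul // leq_mul2l leq_mul2l rq !orbT.
  by rewrite ltn_pmul2r ?muln_gt0 ?q0 // ltn_pmul2r ?muln_gt0 ?d0.
have [|u uw Hu] := @exists_leq_average w
   (fun u => \sum_(v < w) 64 * weight u v) (w * (q * q)).
  under eq_bigr do rewrite -big_distrr /=.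
  rewrite -big_distrr /=; apply: leq_ltn_trans key.
  by rewrite leq_mul2l H.
have [v vw Hv] := @exists_leq_average w (fun v => 64 * weight u v) _ Hu.
by exists u, v.
Qed.

(** The q positions that a row can be shifted to lie in two consecutive row groups, so the box of
    shifts contains at most 2m zeros. *)
Let box_bound u v i : u < w -> v < w ->
  32 * \sum_(b < q) \sum_(a < q) bad u v i a b <= q * q.
Proof.
move=> uw vw; have [iq piq] := pi_bound (ltn_ord i).
have Ri := spread_bound q0 iq; have Ci := spread_bound q0 piq.
rewrite exchange_big /=.
set X := u + spread q i.
apply: (@leq_trans (32 * (m + m))); last by lia.
rewrite leq_mul2l /=.
pose F x y : nat := ((x %/ q == X %/ q) && z x y)
  + ((x %/ q == (X %/ q).+1) && z x y).
apply: leq_trans (leq_add (Hrow (X %/ q)) (Hrow (X %/ q).+1)).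
rewrite -big_split /=; under [leqRHS]eq_bigr do rewrite -big_split /=.
rewrite -/n; apply: leq_trans (@leq_sum_shift n q X
  (fun x => \sum_(y < n) F x y) _); last first.
  by rewrite /X /n; move: Ri uw; rewrite /w; lia.
apply: leq_sum => a _.
apply: leq_trans (@leq_sum_shift n q (v + spread q (pi i)) (F (a + X)) _);
  last first.
  by rewrite /n; move: Ci vw; rewrite /w; lia.
apply: leq_sum => b _; rewrite /F.
rewrite /bad -/X [b + _]addnC [X + a]addnC.
case: (z _ _); rewrite ?andbF // !andbT.
have lo : X %/ q <= (a + X) %/ q by rewrite leq_div2r // leq_addl.
have hi : (a + X) %/ q <= (X %/ q).+1.
  have : a + X <= q + X by rewrite leq_add2r ltnW.
  by move=> /(leq_div2r q); rewrite [leqRHS]divnDl // divnn q0.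
have : ((a + X) %/ q == X %/ q) || ((a + X) %/ q == (X %/ q).+1).
  move: lo hi; move: (X %/ q) ((a + X) %/ q) => s t.
  rewrite leq_eqVlt => /orP[/eqP->|h1 h2]; first by rewrite eqxx.
  by apply/orP; right; lia.
by case/orP=> ->; rewrite ?leq_addr // leq_addl.
Qed.

Lemma occurs_regular :
  occurs k pi (fun x y => [&& x < 4 * q * d, y < 4 * q * d & ~~ z x y]).
Proof.
have [u [v [uw vw Hw]]] := good_offset.
have split_weight : weight u v = q * q * (N R u v 0 0 + N C u v 0 0)
    + q * (\sum_(a < q) N R u v a 0) + q * (\sum_(b < q) N C u v 0 b)
    + \sum_(b < q) \sum_(a < q) N C u v a b.
  rewrite /weight; under eq_bigr do rewrite !big_split /= !sum_nat_const card_ord.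
  rewrite !big_split /= !sum_nat_const card_ord -big_distrr /=.
  by rewrite [X in _ = _ + X]exchange_big /= mulnDr !mulnA.
have T0 G : N G u v 0 0 = 0 -> forall i j, i != j -> G i = G j ->
    bad u v i 0 0 -> bad u v j 0 0 -> False.
  move=> N0 i j ij Gij bi bj; move: N0.
  by rewrite /N (bigD1 i) //= (bigD1 j) //= ij Gij eqxx bi bj.
have N0 : N R u v 0 0 + N C u v 0 0 = 0.
  apply/eqP; rewrite -leqn0 -ltnS -(@ltn_pmul2l (q * q)) ?muln_gt0 ?q0 // muln1.
  apply: leq_ltn_trans Hw; rewrite split_weight.
  by apply: leq_trans (leq_pmull _ _) => //; rewrite -!addnA leq_addr.
have [|||||alpha [beta [Ha Hb Hab]]] := @repair k q R C (bad u v) q0.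
- move=> i j ij [e|e]; [apply: (T0 R) e | apply: (T0 C) e] => //; lia.
- suff : 64 * (q * \sum_(a < q) N R u v a 0) < q * q.
    rewrite mulnCA ltn_pmul2l // /N; congr (_ * _ < _).
    rewrite exchange_big; apply: eq_bigr => i _ /=.
    by rewrite exchange_big; apply: eq_bigr => j _ /=; rewrite big_distrr.
  by move: Hw; rewrite split_weight; lia.
- suff : 64 * (q * \sum_(b < q) N C u v 0 b) < q * q.
    rewrite mulnCA ltn_pmul2l // /N; congr (_ * _ < _).
    rewrite exchange_big; apply: eq_bigr => i _ /=.
    by rewrite exchange_big; apply: eq_bigr => j _ /=; rewrite big_distrr.
  by move: Hw; rewrite split_weight; lia.
- suff : 64 * (\sum_(b < q) \sum_(a < q) N C u v a b) < q * q.
    rewrite /N; congr (_ * _ < _).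
    under [LHS]eq_bigr => b _ do rewrite exchange_big /=.
    rewrite exchange_big; apply: eq_bigr => i _ /=.
    under [LHS]eq_bigr => b _ do rewrite exchange_big /=.
    rewrite exchange_big; apply: eq_bigr => j _ /=.
    by rewrite big_distrr; apply: eq_bigr => b _; rewrite big_distrr.
  by move: Hw; rewrite split_weight; lia.
- by move=> i; exact: box_bound.
exists (fun i => u + (spread q i + alpha (i %/ q))),
  (fun j => v + (spread q j + beta (j %/ q))); split.
- move=> i j /andP[ij jk]; rewrite ltn_add2l.
  by apply: spread_increasing => // ->.
- move=> i j /andP[ij jk]; rewrite ltn_add2l.
  by apply: spread_increasing => // ->.
- move=> i ik; have [iq piq] := pi_bound ik.
  have := spread_bound q0 iq; have := spread_bound q0 piq.
  have := Ha (i %/ q); have := Hb (pi i %/ q).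
  have := Hab (Ordinal ik); rewrite /bad /R /C /= -addnA -[v + _ + _]addnA => ->.
  rewrite andbT.
  move: uw vw; rewrite /w; clear; move: (spread q i) (spread q (pi i)).
  move: (alpha _) (beta _) => *; apply/andP; split; lia.
Qed.
End Regular.

(** * Matrices with few zeros *)

Lemma increasing_below_inj n (f : nat -> nat) x y :
  increasing_below n f -> x < n -> y < n -> f x = f y -> x = y.
Proof.
move=> fi xn yn fxy; case: (ltngtP x y) => // lt.
  by have := fi x y; rewrite lt yn fxy ltnn => /(_ isT).
by have := fi y x; rewrite lt xn fxy ltnn => /(_ isT).
Qed.

Lemma leq_sum_increasing n' n (phi : nat -> nat) (F : nat -> nat) :
  increasing_below n' phi -> (forall x, x < n' -> phi x < n) ->
  \sum_(x < n') F (phi x) <= \sum_(x < n) F x.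
Proof.
move=> phii phin; apply: (@leq_sum_inj 'I_n' (fun x => phi x)) => [x y|x].
  by move=> /(increasing_below_inj phii (ltn_ord x) (ltn_ord y)) /val_inj.
exact: phin.
Qed.

Lemma sum_nat_count n (P : pred nat) :
  \sum_(x < n) (P x : nat) = count P (iota 0 n).
Proof.
rewrite -(big_mkord xpredT (fun x => P x : nat)) /index_iota subn0.
by rewrite -sum1_count [RHS]big_mkcond; apply: eq_bigr => i _; case: (P i).
Qed.

Lemma enumerate_below n c (P : pred nat) : c <= \sum_(x < n) (P x : nat) ->
  exists alpha, increasing_below c alpha /\
    forall g, g < c -> alpha g < n /\ P (alpha g).
Proof.
rewrite sum_nat_count -size_filter; set s := [seq x <- _ | _] => cs.
exists (nth 0 s); split.
  move=> i j /andP[ij jc]; have js := leq_trans jc cs.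
  apply: (sorted_ltn_nth ltn_trans) => //; last by rewrite inE (ltn_trans ij).
  by rewrite sorted_filter ?iota_ltn_sorted //; exact: ltn_trans.
move=> g gc; have gs : g < size s := leq_trans gc cs.
by have := mem_nth 0 gs; rewrite mem_filter mem_iota => /andP[-> /andP[_ ->]].
Qed.

(** Fewer than half of the [8 * d] groups can have more than [m] zeros, so at least [4 * d] light
    ones are left. *)
Lemma enumerate_light_groups q d m n (z : rel nat) :
  0 < q -> n = q * (8 * d) ->
  \sum_(x < n) \sum_(y < n) (z x y : nat) < 4 * d * m.+1 ->
  exists alpha, increasing_below (4 * d) alpha /\
    forall g, g < 4 * d -> alpha g < 8 * d /\
      \sum_(x < n) \sum_(y < n) ((x %/ q == alpha g) && z x y) <= m.
Proof.
move=> q0 nqd Hz; pose F g := \sum_(x < n) \sum_(y < n) ((x %/ q == g) && z x y).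
apply: (@enumerate_below (8 * d) (4 * d) (fun g => F g <= m)).
have S : \sum_(g < 8 * d) F g <= \sum_(x < n) \sum_(y < n) (z x y : nat).
  rewrite /F exchange_big; apply: leq_sum => x _ /=.
  rewrite exchange_big; apply: leq_sum => y _ /=.
  case: (z x y); last by rewrite big1 // => g _; rewrite andbF.
  have xd : x %/ q < 8 * d by rewrite ltn_divLR // mulnC -nqd.
  rewrite (bigD1 (Ordinal xd)) //= eqxx big1 // => g ne.
  by apply/eqP; rewrite eqb0 andbT eq_sym -[x %/ q]/(val (Ordinal xd)) (inj_eq val_inj).
have := leq_ltn_trans (leq_trans (markov_strict (8 * d) F m) S) Hz.
rewrite ltn_pmul2r // => bad.
have : \sum_(g < 8 * d) ((m < F g) + (F g <= m)) = 8 * d.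
  under eq_bigr => g _ do rewrite ltnNge addn_negb.
  by rewrite sum_nat_const card_ord muln1.
rewrite big_split /=; move: bad.
move: (\sum_(i < 8 * d) (m < F i)) (\sum_(i < 8 * d) (F i <= m)) => s t; lia.
Qed.

Section Sparse.
Variables (k q d rho : nat) (pi pi' : nat -> nat) (z : rel nat).
Hypotheses (q0 : 0 < q) (k0 : 0 < k) (kqd : k <= q * d)
  (rhoq : rho * q ^ 3 <= k) (Hpi : inverse_below k pi pi')
  (Hrep : forall i0 j0, i0 < k -> j0 < k ->
     \sum_(i < k) \sum_(j < k) [&& i != j :> nat, i + j0 == j + i0
        & pi i + pi j0 == pi j + pi i0] <= rho).

Let group_map (alpha : nat -> nat) x := q * alpha (x %/ q) + x %% q.

Let group_mapE alpha x : group_map alpha x %/ q = alpha (x %/ q).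
Proof. by rewrite /group_map mulnC divnMDl // (divn_small (ltn_pmod x q0)) addn0. Qed.

Let group_map_increasing alpha : increasing_below (4 * d) alpha ->
  increasing_below (4 * q * d) (group_map alpha).
Proof.
move=> ai x y /andP[xy yn]; rewrite /group_map.
have Hx := ltn_pmod x q0.
have := leq_div2r q (ltnW xy); rewrite leq_eqVlt => /orP[/eqP e|lt].
  by rewrite e ltn_add2l; have := divn_eq x q; have := divn_eq y q; rewrite e; lia.
have : alpha (x %/ q) < alpha (y %/ q).
  by apply: ai; rewrite lt ltn_divLR //; move: yn; lia.
by move=> h; have : q * (alpha (x %/ q)).+1 <= q * alpha (y %/ q);
  [rewrite leq_mul2l h orbT | lia].
Qed.

Let group_map_bound alpha : (forall g, g < 4 * d -> alpha g < 8 * d) ->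
  forall x, x < 4 * q * d -> group_map alpha x < 8 * q * d.
Proof.
move=> ab x xn; have xd : x %/ q < 4 * d by rewrite ltn_divLR //; move: xn; lia.
have Hx := ltn_pmod x q0.
have : q * (alpha (x %/ q)).+1 <= q * (8 * d) by rewrite leq_mul2l ab ?orbT.
by rewrite /group_map; lia.
Qed.

Let group_count m alpha beta (z0 : rel nat) :
  increasing_below (4 * d) alpha -> increasing_below (4 * d) beta ->
  (forall g, g < 4 * d -> alpha g < 8 * d /\
    \sum_(x < 8 * q * d) \sum_(y < 8 * q * d) ((x %/ q == alpha g) && z0 x y)
      <= m) ->
  (forall g, g < 4 * d -> beta g < 8 * d) ->
  forall g, \sum_(x < 4 * q * d) \sum_(y < 4 * q * d)
    ((x %/ q == g) && z0 (group_map alpha x) (group_map beta y)) <= m.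
Proof.
move=> ai bi Ha Hb g; case: (ltnP g (4 * d)) => gd; last first.
  rewrite big1 // => x _; rewrite big1 // => y _.
  suff /negbTE -> : x %/ q != g by [].
  have : x %/ q < 4 * d by rewrite ltn_divLR //; have := ltn_ord x; lia.
  by move=> h; apply/eqP => e; move: h; rewrite e ltnNge gd.
have [_ Hg] := Ha g gd; apply: leq_trans Hg.
have ab h : h < 4 * d -> alpha h < 8 * d by move=> /Ha [].
pose F x := \sum_(y < 8 * q * d) ((x %/ q == alpha g) && z0 x y).
apply: leq_trans (leq_sum_increasing F (group_map_increasing ai)
  (group_map_bound ab)).
apply: leq_sum => x _.
apply: leq_trans (leq_sum_increasing (fun y => (_ && _) : nat)
  (group_map_increasing bi) (group_map_bound Hb)).
apply: leq_sum => y _; rewrite group_mapE.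
by have [->|] := eqVneq (x %/ q) g; rewrite ?eqxx.
Qed.

Lemma occurs_sparse :
  16 * \sum_(x < 8 * q * d) \sum_(y < 8 * q * d) (z x y : nat) <= d * (q * q) ->
  occurs k pi (fun x y => [&& x < 8 * q * d, y < 8 * q * d & ~~ z x y]).
Proof.
move=> Hz; pose m := q * q %/ 64.
have mq : 64 * m <= q * q by rewrite mulnC leq_divM.
have qm : q * q < 64 * m.+1 by rewrite mulnC ltn_ceil.
have d0 : 0 < d by case: (d) kqd => //; rewrite muln0; lia.
have nE : 8 * q * d = q * (8 * d) by lia.
have zm : \sum_(x < 8 * q * d) \sum_(y < 8 * q * d) (z x y : nat) < 4 * d * m.+1.
  rewrite -(@ltn_pmul2l 16) //; apply: leq_ltn_trans Hz _.
  by rewrite (_ : 16 * _ = d * (64 * m.+1)) ?ltn_pmul2l //; lia.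
have [alpha [ai Ha]] := enumerate_light_groups q0 nE zm.
have zm' : \sum_(x < 8 * q * d) \sum_(y < 8 * q * d) (z y x : nat) < 4 * d * m.+1.
  by rewrite exchange_big.
have [beta [bi Hb]] := @enumerate_light_groups _ _ _ _ (fun x y => z y x) q0 nE zm'.
have ab h : h < 4 * d -> alpha h < 8 * d by move=> /Ha [].
have bb h : h < 4 * d -> beta h < 8 * d by move=> /Hb [].
have rows := group_count ai bi Ha bb.
have cols g : \sum_(x < 4 * q * d) \sum_(y < 4 * q * d)
    ((y %/ q == g) && z (group_map alpha x) (group_map beta y)) <= m.
  by rewrite exchange_big; exact: (@group_count _ _ _ (fun x y => z y x) bi ai Hb ab).
have := @occurs_regular _ _ _ _ _ _ _
  (fun x y => z (group_map alpha x) (group_map beta y))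
  q0 k0 kqd rhoq mq Hpi Hrep rows cols.
apply: (@occurs_sub _ _ pi' (4 * q * d) (4 * q * d) _ _
  (group_map alpha) (group_map beta)) => //.
- exact: group_map_increasing.
- exact: group_map_increasing.
- by move=> x y /and3P[xn yn ->]; rewrite !group_map_bound.
Qed.
End Sparse.

(** * Windows of rows *)

Definition hit (A : rel nat) (o w y : nat) : bool :=
  has (fun x => A x y) (iota o w).

Definition hits (A : rel nat) (t o w : nat) : nat := \sum_(y < t) hit A o w y.

Lemma hitP (A : rel nat) o w y :
  reflect (exists2 x, o <= x < o + w & A x y) (hit A o w y).
Proof.
apply: (iffP hasP) => -[x xw Axy]; exists x => //.
  by rewrite mem_iota in xw.
by rewrite mem_iota.
Qed.

Lemma hit_sub (A : rel nat) o w o' w' y :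
  o <= o' -> o' + w' <= o + w -> hit A o' w' y -> hit A o w y.
Proof.
move=> oo ww /hitP[x /andP[h1 h2] Axy]; apply/hitP; exists x => //.
by apply/andP; split; lia.
Qed.

Lemma hits_sub (A : rel nat) t o w o' w' :
  o <= o' -> o' + w' <= o + w ->
  hits A t o w = hits A t o' w' +
    \sum_(y < t) (hit A o w y && ~~ hit A o' w' y).
Proof.
move=> oo ww; rewrite /hits -big_split; apply: eq_bigr => y _ /=.
have := @hit_sub A o w o' w' y oo ww.
by case: (hit A o' w' y); case: (hit A o w y) => // /(_ isT).
Qed.

(* A window all of whose parts miss many columns has a part in which the      *)
(* number of columns hit drops by the factor 1 - 1/E; this cannot go on,      *)
(* because every row hits s columns.                                          *)
Lemma exists_homogeneous_window (A : rel nat) t s M E D o :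
  0 < M -> 0 < E ->
  (forall x, o <= x < o + M ^ D -> s <= \sum_(y < t) A x y) ->
  hits A t o (M ^ D) * E.-1 ^ D < s * E ^ D ->
  exists o' h, s <= hits A t o' (M ^ h.+1) /\
    E * \sum_(i < M) (hits A t o' (M ^ h.+1) - hits A t (o' + i * M ^ h) (M ^ h))
      <= M * hits A t o' (M ^ h.+1).
Proof.
move=> M0 E0; elim: D o => [|D IH] o Hs.
  rewrite !expn0 !muln1 ltnNge; case/negP; apply: leq_trans (Hs o _) _.
    by rewrite leqnn expn0 addn1 ltnS leqnn.
  by apply: leq_sum => y _; rewrite /hit /= orbF.
move=> Hu; set u := hits A t o (M ^ D.+1) in Hu *.
have [le|gt] := leqP (E * \sum_(i < M)
    (u - hits A t (o + i * M ^ D) (M ^ D))) (M * u).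
  exists o, D; split=> //; have MD : 0 < M ^ D.+1 by rewrite expn_gt0 M0.
  apply: leq_trans (Hs o _) _; first by rewrite leqnn -[X in X < _]addn0 ltn_add2l.
  apply: leq_sum => y _; case Aoy: (A o y) => //; rewrite lt0b; apply/hitP.
  by exists o => //; rewrite leqnn -[X in X < _]addn0 ltn_add2l.
have [i iM Hi] : exists2 i, i < M & u < E * (u - hits A t (o + i * M ^ D) (M ^ D)).
  apply: contrapT => H; move: gt; apply/negP; rewrite -leqNgt.
  rewrite big_distrr -[X in X * u]card_ord -sum_nat_const; apply: leq_sum => i _.
  by rewrite leqNgt; apply/negP => lt; apply: H; exists i.
have iw : o + i * M ^ D + M ^ D <= o + M ^ D.+1.
  by rewrite -addnA leq_add2l expnS addnC -mulSn leq_mul2r iM orbT.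
apply: (IH (o + i * M ^ D)).
  move=> x /andP[h1 h2]; apply: Hs; rewrite (leq_trans _ h1) ?leq_addr //=.
  exact: leq_trans h2 iw.
set v := hits A t (o + i * M ^ D) (M ^ D) in Hi *.
have vu : E * v <= E.-1 * u.
  have : E * u = E.-1 * u + u by rewrite -{1}(prednK E0) mulSn addnC.
  by rewrite mulnBr in Hi; lia.
rewrite -(@ltn_pmul2l E) //; apply: leq_ltn_trans (_ : u * E.-1 ^ D.+1 < _).
  by rewrite mulnA expnS mulnA [u * _]mulnC leq_mul2r vu orbT.
by rewrite mulnCA -expnS.
Qed.

(** * Wide matrices contain the permutation *)

Section Wide.
Variables (k q d rho : nat) (pi pi' : nat -> nat).
Hypotheses (q0 : 0 < q) (k0 : 0 < k) (kqd : k <= q * d)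
  (rhoq : rho * q ^ 3 <= k) (Hpi : inverse_below k pi pi')
  (Hrep : forall i0 j0, i0 < k -> j0 < k ->
     \sum_(i < k) \sum_(j < k) [&& i != j :> nat, i + j0 == j + i0
        & pi i + pi j0 == pi j + pi i0] <= rho).

Let M := 8 * q * d.
Let E := 2048 * d.

(** In a homogeneous window, contract each of the [M] parts to one row. On the columns hit by the
    window this gives a matrix with few zeros; some M x M piece of it is sparse enough for
    [occurs_sparse], and the contraction is then undone. *)
Lemma occurs_wide (A : rel nat) t D :
  (forall x, x < M ^ D -> M <= \sum_(y < t) A x y) ->
  t * E.-1 ^ D < M * E ^ D -> occurs k pi A.
Proof.
move=> Hrow HD.
have d0 : 0 < d by case: (d) kqd => //; rewrite muln0; lia.
have M0 : 0 < M by rewrite !muln_gt0 q0 d0.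
have E0 : 0 < E by rewrite muln_gt0 d0.
have hits_t : hits A t 0 (M ^ D) <= t.
  rewrite -[X in _ <= X]muln1 -[X in _ <= X * _]card_ord -sum_nat_const.
  by apply: leq_sum => y _; case: hit.
have [b [h [Mu HE]]] := @exists_homogeneous_window A t M M E D 0 M0 E0 Hrow
  (leq_ltn_trans (leq_mul hits_t (leqnn _)) HD).
set u := hits A t b (M ^ h.+1) in Mu HE.
(* The first [g * M] hit columns are split into [g] interleaved classes of [M] columns, and a class
   with few zeros is taken. Dropping the rest loses a factor 2 at most, as [u < 2 * g * M]; the
   constant 2048 in [E] absorbs it. *)
pose g := u %/ M.
have g0 : 0 < g by rewrite divn_gt0.
have [gamma [gi Hg]] := @enumerate_below t (g * M) (hit A b (M ^ h.+1))
  (leq_divM u M).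
pose row i y := hit A (b + i * M ^ h) (M ^ h) y.
pose col e m := gamma (g * m + e).
have colb e m : e < g -> m < M -> g * m + e < g * M.
  move=> eg mM; have : g * m.+1 <= g * M by rewrite leq_mul2l mM orbT.
  by rewrite mulnS; lia.
pose S e := \sum_(i < M) \sum_(m < M) (~~ row i (col e m) : nat).
have [e eg He] : exists2 e, e < g & E * S e < (2 * (M * M)).+1.
  apply: (@exists_leq_average g (fun e => E * S e)).
  rewrite -big_distrr /=.
  have HS : \sum_(e < g) S e <=
      \sum_(i < M) (u - hits A t (b + i * M ^ h) (M ^ h)).
    rewrite /S exchange_big; apply: leq_sum => i _ /=.
    have iw : b + i * M ^ h + M ^ h <= b + M ^ h.+1.
      by rewrite -addnA leq_add2l expnS addnC -mulSn leq_mul2r ltn_ord orbT.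
    rewrite /u (hits_sub A t (leq_addr _ _) iw) addKn pair_big /=.
    pose F y := (hit A b (M ^ h.+1) y && ~~ row i y) : nat.
    apply: leq_trans (@leq_sum_inj ('I_g * 'I_M)%type
      (fun p => col p.1 p.2) t F _ _).
    - apply: leq_sum => -[e m] _ /=; rewrite /F.
      by have [_ ->] := Hg _ (colb _ _ (ltn_ord e) (ltn_ord m)).
    - move=> [e m] [e' m'] /= ee.
      have := increasing_below_inj gi (colb _ _ (ltn_ord e) (ltn_ord m))
        (colb _ _ (ltn_ord e') (ltn_ord m')) ee.
      move=> eq1; have := congr1 (fun x => x %/ g) eq1.
      have := congr1 (fun x => x %% g) eq1.
      rewrite ![g * _]mulnC !modnMDl !divnMDl // !modn_small // !divn_small //.
      by rewrite !addn0 => /val_inj -> /val_inj ->.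
    - by move=> [e m] /=; have [] := Hg _ (colb _ _ (ltn_ord e) (ltn_ord m)).
  have uM : u < 2 * g * M.
    have : u < g.+1 * M by rewrite ltn_ceil.
    by move=> /leq_trans; apply; rewrite leq_mul2r; apply/orP; right; lia.
  have : E * \sum_(e < g) S e <= M * u.
    by apply: leq_trans HE; rewrite leq_mul2l HS orbT.
  move=> /leq_ltn_trans; apply; apply: (@leq_ltn_trans (M * (2 * g * M))).
    by rewrite leq_mul2l ltnW ?orbT.
  by rewrite mulnS; lia.
have Hsparse : 16 * S e <= d * (q * q).
  rewrite -(@leq_pmul2l (128 * d)) ?muln_gt0 //; move: He.
  by rewrite ltnS /E /M; lia.
have Hocc := @occurs_sparse _ _ _ _ _ _ (fun i m => ~~ row i (col e m))
  q0 k0 kqd rhoq Hpi Hrep Hsparse.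
have Hrows : occurs k pi row.
  apply: (@occurs_sub _ _ _ M M row _ id (col e) Hpi _ _ _ Hocc).
  - by move=> i j /andP[].
  - move=> i j /andP[ij jM]; apply: gi; rewrite colb // andbT.
    by rewrite ltn_add2r ltn_pmul2l.
  - by move=> x y /and3P[-> -> /negPn].
apply: (@occurs_contract _ _ _ A row (fun x => (x - b) %/ M ^ h) id Hpi _ _ _ Hrows).
- by move=> x y xy; rewrite leq_div2r // leq_sub2r.
- by [].
- move=> i y /hitP[x /andP[h1 h2] Axy]; exists x, y; split=> //.
  have Mh : 0 < M ^ h by rewrite expn_gt0 M0.
  have -> : x - b = i * M ^ h + (x - b - i * M ^ h) by lia.
  by rewrite divnMDl // divn_small ?addn0 //; lia.
Qed.
End Wide.

(** * Recursion over blocks *)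

Lemma sum_blocks n t (F : nat -> nat) :
  \sum_(x < n * t) F x = \sum_(I < n) \sum_(x < t) F (I * t + x).
Proof.
elim: n => [|n IH]; first by rewrite mul0n !big_ord0.
by rewrite big_ord_recr /= -IH mulSnr big_split_ord.
Qed.

Lemma sum_le_blocks n n' t (F : nat -> nat) : n <= n' * t ->
  \sum_(x < n) F x <= \sum_(I < n') \sum_(x < t) F (I * t + x).
Proof.
move=> nn; rewrite -sum_blocks.
have := @leq_sum_shift (n' * t) n 0 F; rewrite addn0 => /(_ nn).
by under eq_bigr do rewrite addn0.
Qed.

Definition restrict (n : nat) (A : rel nat) : rel nat :=
  fun x y => [&& x < n, y < n & A x y].

Definition nonempty_columns (t : nat) (A : rel nat) (I J : nat) : nat :=
  \sum_(y < t) hit A (I * t) t (J * t + y).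

(** Contracting each of [N] wide blocks of the strip to a single row would give a matrix to which
    the hypothesis on [B] applies, and the pattern would lift to [A]. *)
Lemma wide_blocks_bound k pi pi' s t N (A : rel nat) n' J :
  inverse_below k pi pi' -> 0 < t ->
  (forall B : rel nat, (forall x, x < N -> s <= \sum_(y < t) B x y) ->
     occurs k pi B) ->
  ~ occurs k pi A ->
  \sum_(I < n') (s <= nonempty_columns t A I J) <= N.
Proof.
move=> Hpi t0 HW HA; rewrite leqNgt; apply/negP => lt; apply: HA.
have [alpha [ai Ha]] := @enumerate_below n' N
  (fun I => s <= nonempty_columns t A I J) (ltnW lt).
pose B x y := [&& x < N, y < t & hit A (alpha x * t) t (J * t + y)].
have /HW HB : forall x, x < N -> s <= \sum_(y < t) B x y.
  move=> x xN; have [_] := Ha x xN => /leq_trans; apply.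
  by apply: leq_sum => y _; rewrite /B xN ltn_ord.
pose A' I y := hit A (I * t) t y.
have : occurs k pi A'.
  apply: (@occurs_sub _ _ _ N t A' B alpha (fun y => J * t + y) Hpi _ _ _ HB) => //.
    by move=> i j /andP[ij _]; rewrite ltn_add2l.
  by move=> x y /and3P[xN yt Bxy]; split.
apply: (@occurs_contract _ _ _ A A' (fun x => x %/ t) id Hpi) => //.
  by move=> x y xy; rewrite leq_div2r.
move=> I y /hitP[x /andP[h1 h2] Axy]; exists x, y; split=> //.
have -> : x = I * t + (x - I * t) by lia.
by rewrite divnMDl // divn_small ?addn0 //; lia.
Qed.

Section Recursion.
Variables (k : nat) (pi pi' : nat -> nat) (s N : nat).
Let t := 4 * (s * s).
Hypotheses (s0 : 0 < s) (N0 : 0 < N) (Hpi : inverse_below k pi pi')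
  (HW : forall B : rel nat, (forall x, x < N -> s <= \sum_(y < t) B x y) ->
     occurs k pi B)
  (HW' : forall B : rel nat, (forall x, x < N -> s <= \sum_(y < t) B x y) ->
     occurs k pi' B).

Let block (A : rel nat) I J := \sum_(x < t) \sum_(y < t) A (I * t + x) (J * t + y).

(* The ones of a block lie in the product of its nonempty rows and columns.   *)
Let block_bound (A : rel nat) I J : block A I J <= s * s * (0 < block A I J)
  + t * t * (s <= nonempty_columns t A I J)
  + t * t * (s <= nonempty_columns t (fun x y => A y x) J I).
Proof.
have [->|b0] := posnP (block A I J); first by rewrite leq0n.
rewrite muln1.
have prod : block A I J <= nonempty_columns t (fun x y => A y x) J I
    * nonempty_columns t A I J.
  rewrite /block /nonempty_columns big_distrl; apply: leq_sum => x _ /=.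
  rewrite big_distrr; apply: leq_sum => y _ /=.
  case Axy: (A _ _) => //; rewrite muln_gt0 !lt0b; apply/andP; split.
    by apply/hitP; exists (J * t + y) => //; rewrite leq_addr ltn_add2l ltn_ord.
  by apply/hitP; exists (I * t + x) => //; rewrite leq_addr ltn_add2l ltn_ord.
have le_t (B : rel nat) I' J' : nonempty_columns t B I' J' <= t.
  rewrite -[leqRHS]muln1 -[X in _ <= X * _]card_ord -sum_nat_const.
  by apply: leq_sum => y _; case: hit.
apply: (leq_trans prod).
have [w|nw] := leqP s (nonempty_columns t A I J).
  by rewrite muln1 -addnA addnCA (leq_trans (leq_mul (le_t _ _ _) (le_t _ _ _))) ?leq_addr.
have [w'|nw'] := leqP s (nonempty_columns t (fun x y => A y x) J I).
  by rewrite muln1 addnC (leq_trans (leq_mul (le_t _ _ _) (le_t _ _ _))) ?leq_addr.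
by rewrite !muln0 !addn0 leq_mul // ltnW.
Qed.

(** The matrix of nonzero blocks avoids the pattern too, so induction bounds their number. As s^2 =
    t/4, the recursive term and the wide and tall blocks each contribute 2t^2 N n' or, for the
    latter two together, the same amount; the sum is at most 8tNn because t n' <= 2n. *)
Lemma ones_linear_bound n (A : rel nat) : ~ occurs k pi (restrict n A) ->
  \sum_(x < n) \sum_(y < n) A x y <= 8 * t * N * n.
Proof.
have t0 : 0 < t by rewrite !muln_gt0 s0.
elim/ltn_ind: n A => n IH A HA.
have [nt|tn] := ltnP n t.
  apply: (@leq_trans (n * n)).
    rewrite -[X in _ <= X * _]card_ord -sum_nat_const; apply: leq_sum => x _.
    rewrite -[leqRHS]muln1 -[X in _ <= X * _]card_ord -sum_nat_const.
    by apply: leq_sum => y _; case: (A x y).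
  rewrite leq_mul2r; apply/orP; right; apply: leq_trans (ltnW nt) _.
  by rewrite -mulnA mulnCA leq_pmulr // muln_gt0.
set A' := restrict n A in HA.
pose n' := (n %/ t).+1.
have nn' : n <= n' * t by rewrite ltnW // ltn_ceil.
pose B I J := 0 < block A' I J.
have HB : ~ occurs k pi (restrict n' B).
  move=> HB; apply: HA.
  apply: (@occurs_contract _ _ _ A' _ (fun x => x %/ t) (fun y => y %/ t) Hpi _ _ _ HB).
  - by move=> x y xy; rewrite leq_div2r.
  - by move=> x y xy; rewrite leq_div2r.
  - move=> I J /and3P[_ _]; rewrite /B lt0n sum_nat_eq0 => /forallPn[x].
    rewrite sum_nat_eq0 => /forallPn[y]; rewrite eqb0 negbK => Axy.
    exists (I * t + x), (J * t + y); split=> //.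
      by rewrite divnMDl // divn_small ?addn0.
    by rewrite divnMDl // divn_small ?addn0.
have n'n : n' < n.
  have t4 : 4 <= t by rewrite /t leq_pmulr ?muln_gt0 ?s0.
  have : n %/ t <= n %/ 4 by rewrite leq_div2l.
  by rewrite /n'; have := leq_divM n 4; lia.
have {}IH := IH _ n'n _ HB.
have step : \sum_(x < n) \sum_(y < n) A x y <=
    \sum_(I < n') \sum_(J < n') block A' I J.
  apply: (@leq_trans (\sum_(x < n) \sum_(y < n) A' x y)).
    by apply: leq_sum => x _; apply: leq_sum => y _; rewrite /A' /restrict !ltn_ord.
  apply: leq_trans (sum_le_blocks (fun x => \sum_(y < n) A' x y) nn') _.
  apply: leq_sum => I _; rewrite /block [leqRHS]exchange_big /=.
  apply: leq_sum => x _.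
  exact: (sum_le_blocks (fun y => A' (I * t + x) y) nn').
apply: (leq_trans step).
have wide : \sum_(I < n') \sum_(J < n') (s <= nonempty_columns t A' I J) <= n' * N.
  rewrite exchange_big -[X in _ <= X * _]card_ord -sum_nat_const.
  by apply: leq_sum => J _; exact: (wide_blocks_bound _ _ Hpi t0 HW HA).
have tall : \sum_(I < n') \sum_(J < n')
    (s <= nonempty_columns t (fun x y => A' y x) J I) <= n' * N.
  rewrite -[X in _ <= X * _]card_ord -sum_nat_const; apply: leq_sum => I _.
  apply: (wide_blocks_bound _ _ (inverse_below_sym Hpi) t0 HW').
  by move=> /(occurs_sym (inverse_below_sym Hpi)).
apply: (@leq_trans (s * s * (8 * t * N * n') + t * t * (n' * N) + t * t * (n' * N))).
  apply: leq_trans (leq_add (leq_add (leq_mul (leqnn (s * s)) IH)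
    (leq_mul (leqnn (t * t)) wide)) (leq_mul (leqnn (t * t)) tall)).
  rewrite !big_distrr -!big_split; apply: leq_sum => I _ /=.
  rewrite !big_distrr -!big_split; apply: leq_sum => J _ /=.
  exact: block_bound.
have tn' : t * n' <= 2 * n.
  by rewrite /n' mulnS; have := leq_divM n t; rewrite mulnC; lia.
have -> : s * s * (8 * t * N * n') + t * t * (n' * N) + t * t * (n' * N)
    = 4 * t * N * (t * n') by rewrite /t; lia.
by rewrite (leq_trans (leq_mul (leqnn _) tn')) //; lia.
Qed.
End Recursion.

(** * Choice of parameters *)

(** Bernoulli's inequality for (1 + 1/e)^m, cleared of denominators. *)
Lemma bernoulli_nat e m : e ^ m * (e + m) <= e.+1 ^ m * e.
Proof.
elim: m => [|m IH]; first by rewrite !expn0 !mul1n addn0.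
rewrite [e.+1 ^ _]expnS -mulnA; apply: leq_trans (leq_mul (leqnn e.+1) IH).
rewrite expnS mulnCA [e * _]mulnC -mulnA leq_mul2l; apply/orP; right.
by rewrite mulnDr; lia.
Qed.

Lemma pred_exp_le_half E : 0 < E -> 2 * E.-1 ^ E <= E ^ E.
Proof.
case: E => // e _ /=; case: (posnP e) => [->|e0]; first by rewrite exp1n muln0.
rewrite -(@leq_pmul2r e) //; apply: leq_trans (bernoulli_nat e e.+1).
by rewrite mulnAC mulnC leq_mul2l; apply/orP; right; lia.
Qed.

(** Every E factors 1 - 1/E at least halve, so E times [lam] of them outweigh [a]. This fixes the
    depth of the descent through windows. *)
Lemma pred_exp_small E lam a : 0 < E -> 0 < lam -> a < 2 ^ lam ->
  a * E.-1 ^ (E * lam) < E ^ (E * lam).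
Proof.
move=> E0 lam0 al; have [->|Y0] := posnP (E.-1 ^ (E * lam)).
  by rewrite muln0 expn_gt0 E0.
apply: (@leq_trans (2 ^ lam * E.-1 ^ (E * lam))); first by rewrite ltn_mul2r Y0.
by rewrite !expnM -expnMn leq_exp2r // pred_exp_le_half.
Qed.

Lemma cube_root_scale rho k : 0 < rho -> rho <= k ->
  exists q, [/\ 0 < q, rho * q ^ 3 <= k & k < rho * q.+1 ^ 3].
Proof.
move=> rho0 rk; pose Q q := (0 < q) && (rho * q ^ 3 <= k).
have Q1 : exists q, Q q by exists 1; rewrite /Q exp1n muln1.
have Qb q : Q q -> q <= k.
  move=> /andP[q0 /(leq_trans _)]; apply; apply: leq_trans (leq_pmull _ rho0).
  by rewrite -[X in X <= _]expn1 leq_pexp2l.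
case: (ex_maxnP Q1 Qb) => q /andP[q0 qk] qmax; exists q; split=> //.
rewrite ltnNge; apply/negP => h; have := qmax q.+1; rewrite /Q h /=.
by move=> /(_ isT); rewrite ltnn.
Qed.

Lemma avoiding_ones_bound k rho pi pi' :
  0 < k -> 0 < rho -> rho <= k -> inverse_below k pi pi' ->
  (forall i0 j0, i0 < k -> j0 < k ->
     \sum_(i < k) \sum_(j < k) [&& i != j :> nat, i + j0 == j + i0
        & pi i + pi j0 == pi j + pi i0] <= rho) ->
  exists d, [/\ 0 < d, d ^ 3 <= 64 * rho * k ^ 2
    & forall n (A : rel nat), ~ occurs k pi (restrict n A) ->
      \sum_(x < n) \sum_(y < n) A x y <=
        32 * (16 * k) ^ (2048 * d * (trunc_log 2 k + 7) + 2) * n].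
Proof.
move=> k0 rho0 rk Hpi Hrep; have [q [q0 qk kq]] := cube_root_scale rho0 rk.
pose d := (k %/ q).+1; pose M := 8 * q * d.
have kqd : k <= q * d by rewrite mulnC ltnW // ltn_ceil.
have q_le_k : q <= k.
  apply: leq_trans qk; apply: leq_trans (leq_pmull _ rho0).
  by rewrite -[X in X <= _]expn1 leq_pexp2l.
have qd : q * d <= 2 * k.
  by rewrite /d mulnS; have := leq_divM k q; rewrite mulnC; lia.
have d0 : 0 < d by [].
have M0 : 0 < M by rewrite !muln_gt0 q0.
(* The ratio to be exhausted is t/M = 4M, which is at most 64k. *)
pose lam := trunc_log 2 k + 7; pose D := 2048 * d * lam.
have Mlam : 4 * M < 2 ^ lam.
  have : k < 2 ^ (trunc_log 2 k).+1 by exact: trunc_log_ltn.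
  have -> : 2 ^ lam = 64 * 2 ^ (trunc_log 2 k).+1.
    by rewrite /lam -(expnD 2 6) addnC addSnnS.
  by rewrite /M; lia.
have HD : 4 * (M * M) * (2048 * d).-1 ^ D < M * (2048 * d) ^ D.
  have -> : 4 * (M * M) * (2048 * d).-1 ^ D = M * (4 * M * (2048 * d).-1 ^ D).
    by rewrite mulnCA -!mulnA.
  by rewrite ltn_pmul2l // pred_exp_small // ?muln_gt0 // /lam addnS.
(* Tall blocks require the transposed pattern; transposition swaps the coordinates of distance
   vectors and keeps their multiplicities. *)
have Hrep' i0 j0 : i0 < k -> j0 < k ->
    \sum_(i < k) \sum_(j < k) [&& i != j :> nat, i + j0 == j + i0
      & pi' i + pi' j0 == pi' j + pi' i0] <= rho.
  move=> i0k j0k; have [_ i0k' _ i0E] := Hpi _ i0k; have [_ j0k' _ j0E] := Hpi _ j0k.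
  apply: leq_trans (Hrep _ _ i0k' j0k').
  pose f (i : 'I_k) : 'I_k := Ordinal (let: And4 _ h _ _ := Hpi i (ltn_ord i) in h).
  have f_inj : injective f.
    move=> i j /(congr1 val) /= e; apply: val_inj => /=.
    have [_ _ _ <-] := Hpi i (ltn_ord i); have [_ _ _ <-] := Hpi j (ltn_ord j).
    by rewrite e.
  rewrite [leqRHS](reindex_inj f_inj); apply: leq_sum => i _.
  rewrite [leqRHS](reindex_inj f_inj); apply: leq_sum => j _ /=.
  have [_ _ _ iE] := Hpi i (ltn_ord i); have [_ _ _ jE] := Hpi j (ltn_ord j).
  rewrite iE jE i0E j0E; case: (boolP (_ && _)) => // /and3P[ij -> ->].
  by case: eqP => // e; case/eqP: ij; rewrite -iE -jE e.
exists d; split=> //.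
  rewrite -(@leq_pmul2r k) //.
  have kq3 : k <= 8 * (rho * q ^ 3).
    apply: (leq_trans (ltnW kq)); rewrite mulnCA leq_mul2l; apply/orP; right.
    by rewrite -(expnMn 2 q 3) leq_exp2r //; lia.
  apply: leq_trans (leq_mul (leqnn _) kq3) _.
  have : (q * d) ^ 3 <= (2 * k) ^ 3 by rewrite leq_exp2r.
  rewrite !expnMn => h.
  have -> : d ^ 3 * (8 * (rho * q ^ 3)) = 8 * rho * (q ^ 3 * d ^ 3) by lia.
  apply: leq_trans (leq_mul (leqnn _) h) _.
  by rewrite [k ^ 3]expnSr; lia.
move=> n A HA.
have HW := @occurs_wide k q d rho pi pi' q0 k0 kqd qk Hpi Hrep.
have HW' := @occurs_wide k q d rho pi' pi q0 k0 kqd qk (inverse_below_sym Hpi) Hrep'.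
apply: leq_trans (@ones_linear_bound k pi pi' M (M ^ D) M0 _ Hpi _ _ n A HA) _.
- by rewrite expn_gt0 M0.
- by move=> B HB; apply: HW HB HD.
- by move=> B HB; apply: HW' HB HD.
rewrite leq_mul2r; apply/orP; right.
have -> : 8 * (4 * (M * M)) * M ^ D = 32 * M ^ (D + 2).
  by rewrite expnD -mulnn; lia.
by rewrite leq_mul2l leq_exp2r ?addn2 //= /M; lia.
Qed.

(** * Matrices and real estimates *)

Definition entry_rel n (A : 'M[bool]_n) : rel nat := fun x y =>
  if insub x is Some i then if insub y is Some j then A i j else false else false.

Lemma entry_relE n (A : 'M[bool]_n) (i j : 'I_n) : entry_rel A i j = A i j.
Proof. by rewrite /entry_rel !valK. Qed.

Lemma one_entries_sum n (A : 'M[bool]_n) :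
  #|one_entries A| = \sum_(x < n) \sum_(y < n) entry_rel A x y.
Proof.
rewrite pair_big -sum1_card big_mkcond; apply: eq_bigr => -[i j] _ /=.
by rewrite inE /= entry_relE; case: (A i j).
Qed.

Definition permutes k (P : 'M[bool]_k) (pi : nat -> nat) : Prop :=
  forall i j : 'I_k, P i j = (pi i == j).

Lemma permutation_matrixP k (P : 'M[bool]_k) : permutation_matrix P ->
  exists pi pi', inverse_below k pi pi' /\ permutes P pi.
Proof.
move=> [Hr Hc].
have /choice[f Hf] : forall i, exists j, P i j.
  by move=> i; have [j [Pij _]] := Hr i; exists j.
have /choice[g Hg] : forall j, exists i, P i j.
  by move=> j; have [i [Pij _]] := Hc j; exists i.
have fU i j : P i j -> f i = j.
  by move=> Pij; have [j' [_ u]] := Hr i; rewrite -(u _ (Hf i)) -(u _ Pij).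
have gU i j : P i j -> g j = i.
  by move=> Pij; have [i' [_ u]] := Hc j; rewrite -(u _ (Hg j)) -(u _ Pij).
pose pi i := if insub i is Some i' then f i' : nat else 0.
pose pi' i := if insub i is Some i' then g i' : nat else 0.
have piE (i : 'I_k) : pi i = f i by rewrite /pi valK.
have pi'E (i : 'I_k) : pi' i = g i by rewrite /pi' valK.
exists pi, pi'; split.
  move=> i ik; rewrite -[i]/(val (Ordinal ik)) piE pi'E; split.
  - exact: ltn_ord.
  - by rewrite pi'E.
  - by rewrite (gU _ _ (Hf _)).
  - by rewrite pi'E piE (fU _ _ (Hg _)).
move=> i j; rewrite piE; apply/idP/eqP => [/fU -> //|/val_inj <-]; exact: Hf.
Qed.

Lemma occurs_contains k pi pi' n (P : 'M[bool]_k) (A : 'M[bool]_n) :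
  inverse_below k pi pi' -> permutes P pi ->
  occurs k pi (restrict n (entry_rel A)) -> contains A P.
Proof.
move=> Hpi HP [f [g [fi gi Hf]]].
have fn (i : 'I_k) : f i < n by have /and3P[] := Hf i (ltn_ord i).
have gn (j : 'I_k) : g j < n.
  have [_ jk _ je] := Hpi j (ltn_ord j).
  by have /and3P[_ + _] := Hf _ jk; rewrite je.
apply/existsP; exists [ffun i => Ordinal (fn i)].
apply/existsP; exists [ffun j => Ordinal (gn j)].
apply/and3P; split.
- apply/forallP => i; apply/forallP => j; apply/implyP => ij.
  by rewrite !ffunE /= fi // ij ltn_ord.
- apply/forallP => i; apply/forallP => j; apply/implyP => ij.
  by rewrite !ffunE /= gi // ij ltn_ord.
- apply/forallP => i; apply/forallP => j; apply/implyP.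
  rewrite HP mxE !ffunE => /eqP e.
  by have /and3P[_ _] := Hf i (ltn_ord i); rewrite e -entry_relE.
Qed.

(** The bound [k] holds because the row difference determines [j] from [i]. Taking the minimum
    covers [r > k], where (k/r)^(1/3) would leave no positive integer for [q]. *)
Lemma repetition_free_count k r (P : 'M[bool]_k) pi pi' :
  inverse_below k pi pi' -> permutes P pi -> repetition_free r P ->
  forall i0 j0, i0 < k -> j0 < k ->
     \sum_(i < k) \sum_(j < k) [&& i != j :> nat, i + j0 == j + i0
        & pi i + pi j0 == pi j + pi i0] <= minn r k.
Proof.
move=> Hpi HP Hr i0 j0 i0k j0k; rewrite leq_min; apply/andP; split; last first.
  rewrite -[X in _ <= X]muln1 -[X in _ <= X * _]card_ord -sum_nat_const.
  apply: leq_sum => i _.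
  have [[j Hj]|no] := pselect (exists j : 'I_k, i + j0 = j + i0).
    rewrite (bigD1 j) //= big1 ?addn0 ?leq_b1 // => j' jj'.
    apply/eqP; rewrite eqb0; apply: contra jj' => /and3P[_ /eqP e _].
    by apply/eqP/val_inj => /=; lia.
  rewrite big1 // => j _; apply/eqP; rewrite eqb0; apply/negP => /and3P[_ /eqP e _].
  by apply: no; exists j.
pose v : int * int := ((j0%:Z - i0%:Z)%R, ((pi j0)%:Z - (pi i0)%:Z)%R).
have := Hr v; rewrite /repeated -ltnNge => /ltnW; apply: leq_trans.
have pik (i : 'I_k) : pi i < k by have [] := Hpi i (ltn_ord i).
pose h (p : 'I_k * 'I_k) :=
  ((p.1, Ordinal (pik p.1)), (p.2, Ordinal (pik p.2))).
have h_inj : injective h by move=> [i j] [i' j'] [] -> _ ->.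
rewrite pair_big /= -sum1_card [leqRHS]big_mkcond /=.
apply: leq_trans (leq_sum_injective _ h_inj); apply: leq_sum => -[i j] _ /=.
case: (boolP [&& _, _ & _]) => // /and3P[ij /eqP e1 /eqP e2].
rewrite !inE /= !HP !eqxx /= /distance_vector /= ifT //; apply/andP; split.
  by apply: contra ij => /eqP[->].
by apply/eqP; congr (_, _); lia.
Qed.

Lemma ex_linear_bound k rho pi pi' (P : 'M[bool]_k) :
  0 < k -> 0 < rho -> rho <= k -> inverse_below k pi pi' -> permutes P pi ->
  (forall i0 j0, i0 < k -> j0 < k ->
     \sum_(i < k) \sum_(j < k) [&& i != j :> nat, i + j0 == j + i0
        & pi i + pi j0 == pi j + pi i0] <= rho) ->
  exists d, [/\ 0 < d, d ^ 3 <= 64 * rho * k ^ 2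
    & forall n, ex n P <=
        32 * (16 * k) ^ (2048 * d * (trunc_log 2 k + 7) + 2) * n].
Proof.
move=> k0 rho0 rk Hpi HP Hrep.
have [d [d0 d3 Hd]] := avoiding_ones_bound k0 rho0 rk Hpi Hrep.
exists d; split=> // n; apply/bigmax_leqP => A avA.
rewrite one_entries_sum; apply: Hd => occ.
by case/negP: avA; exact: occurs_contains Hpi HP occ.
Qed.

Local Close Scope nat_scope.
Local Open Scope ring_scope.

(* If the sequence diverged, [limn] would be the default value 0.             *)
Lemma furedi_hajnal_limit_le (R : realType) k (P : 'M[bool]_k) (K : nat) :
  (forall n, (ex n P <= K * n)%N) -> furedi_hajnal_limit R P <= K%:R.
Proof.
move=> HK; rewrite /furedi_hajnal_limit.
have [cv|ncv] := pselect (cvgn (fun n : nat => (ex n P)%:R / n%:R : R)).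
  apply: limr_le => //; apply: nearW => -[|n].
    by rewrite invr0 mulr0 ler0n.
  by rewrite ler_pdivrMr ?ltr0n // -natrM ler_nat.
by rewrite (dvgP ncv) ler0n.
Qed.

Lemma powR_log2 (R : realType) (x : R) : 0 < x -> 2 `^ (log2 x) = x.
Proof.
move=> x0; rewrite /powR pnatr_eq0 /= /log2 divfK ?lnK //.
by rewrite gt_eqF // ln_gt0 // ltr1n.
Qed.

Lemma log2_trunc_log (R : realType) (k : nat) : (0 < k)%N ->
  (trunc_log 2 k)%:R <= log2 (k%:R : R).
Proof.
move=> k0; have l2 : 0 < ln (2 : R) by rewrite ln_gt0 // ltr1n.
rewrite /log2 ler_pdivlMr // mulr_natl -lnXn // ler_ln ?posrE ?exprn_gt0 ?ltr0n //.
by rewrite -natrX ler_nat trunc_logP.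
Qed.

(** Since k >= 9 gives log k >= 3, all additive constants are absorbed into multiples of log k: the
    exponent is at most 5 + (7/3) * 7000 * d log^2 k, and 128 * 128 exceeds (7/3) * 7000 by enough
    to cover the 5. *)
Lemma log2_exponent_bound (R : realType) (k d : nat) : (9 <= k)%N -> (0 < d)%N ->
  ((32 * (16 * k) ^ (2048 * d * (trunc_log 2 k + 7) + 2))%N)%:R <=
    2 `^ (128 * 128 * d%:R * log2 (k%:R : R) ^+ 2).
Proof.
move=> k9 d0; set x := log2 _; set D := (2048 * d * _)%N.
have k0 : (0 < k)%N by apply: leq_trans k9.
have x3 : 3 <= x.
  apply: le_trans (log2_trunc_log R k0); rewrite ler_nat.
  by apply: (leq_trans (_ : 3 <= trunc_log 2 9)%N) => //; exact: leq_trunc_log.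
have d1 : 1 <= d%:R :> R by rewrite ler1n.
have pow (n : nat) : (2 : R) ^+ n = 2 `^ n%:R by rewrite powR_mulrn.
have -> : ((32 * (16 * k) ^ (D + 2))%N)%:R = 2 `^ (5 + (4 + x) * (D + 2)%:R) :> R.
  rewrite natrM natrX natrM powRD ?pnatr_eq0 ?implybT // -(pow 5) powRrM.
  rewrite powRD ?pnatr_eq0 ?implybT // powR_log2 ?ltr0n // -!pow.
  by rewrite powR_mulrn ?mulr_ge0 ?exprn_ge0 ?ler0n // -[2 ^+ 5]natrX -[2 ^+ 4]natrX.
apply: ler_powR; first by rewrite ler1n.
have -> : (D + 2)%:R = 2048 * d%:R * ((trunc_log 2 k)%:R + 7) + 2 :> R.
  by rewrite /D natrD !natrM natrD.
have l7 : (trunc_log 2 k)%:R + 7 <= 10 / 3 * x.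
  by have := log2_trunc_log R k0; rewrite -/x; lra.
have dx : 3 <= d%:R * x by nra.
have h1 : 2048 * d%:R * ((trunc_log 2 k)%:R + 7) + 2 <= 7000 * (d%:R * x).
  have : d%:R * ((trunc_log 2 k)%:R + 7) <= d%:R * (10 / 3 * x).
    by rewrite ler_wpM2l ?ler0n.
  by rewrite -(mulrA 2048); nra.
set y := 2048 * _ * _ + 2 in h1 *.
have y0 : 0 <= y.
  apply: addr_ge0; last exact: ler0n.
  by apply: mulr_ge0; [apply: mulr_ge0 | apply: addr_ge0]; exact: ler0n.
clearbody y; clear l7; move: x3 dx d1; clearbody x => x3 dx d1.
have h2 : 4 + x <= 7 / 3 * x by lra.
have h3 : (4 + x) * y <= 7 / 3 * x * (7000 * (d%:R * x)).
  by apply: (ler_pM _ y0 h2 h1); lra.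
have h4 : 9 <= d%:R * x ^+ 2.
  have : 3 * 3 <= x * x by apply: ler_pM.
  have : 1 * x ^+ 2 <= d%:R * x ^+ 2 by rewrite ler_wpM2r ?sqr_ge0.
  by rewrite mul1r expr2 => p1 p2; apply: le_trans p1; apply: le_trans p2; lra.
apply: le_trans (lerD (lexx 5) h3) _.
rewrite mulrACA [x * (_ * x)]mulrCA -expr2.
rewrite -[128 * 128 * d%:R * _]mulrA.
move: (d%:R * x ^+ 2) h4 => w; clear; lra.
Qed.

Lemma cube_root_bound (R : realType) (k r rho d : nat) :
  (rho <= r)%N -> (d ^ 3 <= 64 * rho * k ^ 2)%N ->
  d%:R <= 4 * (r%:R `^ (1 / 3) * k%:R `^ (2 / 3)) :> R.
Proof.
move=> rr d3; rewrite -(@ler_pXn2r _ 3) ?nnegrE ?ler0n ?mulr_ge0 ?powR_ge0 //.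
have cube (y s : R) : (y `^ (s / 3)) ^+ 3 = y `^ s.
  by rewrite -powR_mulrn ?powR_ge0 // -powRrM divfK ?pnatr_eq0.
rewrite !exprMn !cube powRr1 ?ler0n // powR_mulrn ?ler0n // -!natrX -!natrM ler_nat.
apply: leq_trans d3 _; rewrite mulnA leq_mul2r leq_mul2l rr !orbT //.
Qed.

Theorem theorem1p1 (R : realType) :
  exists2 C : R, 0 < C &
    forall (k r : nat) (P : 'M[bool]_k),
      (9 <= k)%N -> (3 <= r)%N ->
      permutation_matrix P -> repetition_free r P ->
      furedi_hajnal_limit R P <=
        2 `^ (C * r%:R `^ (1 / 3) * k%:R `^ (2 / 3) * log2 (k%:R : R) ^+ 2).
Proof.
(* The factor 4 comes from [cube_root_bound], the rest from [log2_exponent_bound]. *)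
exists (128 * 128 * 4).
  by rewrite !mulr_gt0 ?ltr0n.
move=> k r P k9 r3 /permutation_matrixP [pi [pi' [Hpi HP]]] Hr.
have k0 : (0 < k)%N by apply: leq_trans k9.
have rho0 : (0 < minn r k)%N by rewrite leq_min k0 andbT (leq_trans _ r3).
have [d [d0 d3 Hd]] := ex_linear_bound k0 rho0 (geq_minr r k) Hpi HP
  (repetition_free_count Hpi HP Hr).
apply: le_trans (furedi_hajnal_limit_le R Hd) _.
apply: le_trans (log2_exponent_bound R k9 d0) _.
apply: ler_powR; first by rewrite ler1n.
rewrite ler_wpM2r ?sqr_ge0 //.
rewrite -[128 * 128 * 4 * _ * _]mulrA -[128 * 128 * 4 * _]mulrA.
apply: ler_wpM2l; first by rewrite mulr_ge0 ?ler0n.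
exact: cube_root_bound (geq_minl r k) d3.
Qed.
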